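(* Let $G$ be a DMG, and let $P$ be a DPAG that contains $G$ and such that all unshielded triples in $P$ have been oriented according to FCI rule R0 using $\mathrm{IM}_\sigma(G)$. Let $i\neq j$ be two nodes in $P$. If - there is a directed path from $i$ to $j$ in $P$, or - there exist uncovered possibly directed paths from $i$ to $j$ in $P$ of the form $i,u,\dots,j$ and $i,v,\dots,j$ such that $u,v$ are distinct non-adjacent nodes in $P$, then $i\in\mathrm{an}_G(j)$.
   Context: DMGs. A directed mixed graph (DMG) $G=\langle V,E,F\rangle$ has a finite node set $V$, directed edges $i\to j$ and bidirected edges $i\leftrightarrow j$ between distinct nodes; several edges between two nodes are allowed (at most one of each of $i\to j$, $i\leftarrow j$, $i\leftrightarrow j$). A walk is an alternating sequence of nodes and edges, each edge connecting consecutive nodes; a path is a walk containing each node at most once. $\mathrm{an}_G(j)$ is the set of nodes $i$ with a (possibly trivial) directed path $i\to\dots\to j$; $\mathrm{de}_G(i)=\{j:i\in\mathrm{an}_G(j)\}$; $\mathrm{sc}_G(i)=\mathrm{an}_G(i)\cap\mathrm{de}_G(i)$; $\mathrm{an}_G(I)=\bigcup_{i\in I}\mathrm{an}_G(i)$. A non-endpoint node on a walk is a collider if both adjacent walk edges have an arrowhead at it; other nodes on it are non-colliders. $\sigma$-separation. A walk is $\sigma$-blocked by $C\subseteq V$ if: its first or last node is in $C$; or it contains a collider not in $\mathrm{an}_G(C)$; or it contains a non-endpoint non-collider $k\in C$ with a directed walk edge $k\to l$ to a neighbouring node $l$ on the walk with $l\notin\mathrm{sc}_G(k)$. $A$ is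 $\sigma$-separated from $B$ by $C$ if all paths between nodes of $A$ and nodes of $B$ are $\sigma$-blocked by $C$. $\mathrm{IM}_\sigma(G)$ is the set of triples $\langle A,B,C\rangle$ of subsets of $V$ such that $A$ is $\sigma$-separated from $B$ by $C$. Inducing paths. An inducing path between $i$ and $j$ in a DMG $G$ is a path between them on which every collider is in $\mathrm{an}_G(\{i,j\})$ and each non-endpoint non-collider only has outgoing directed edges (on the path) to neighbouring nodes on the path in the same strongly connected component of $G$. DPAGs. A directed partial ancestral graph (DPAG) is a mixed graph with edges of types $\to,\leftarrow,\leftrightarrow,\circ\!\!\to,\leftarrow\!\!\circ,\circ\!\!-\!\!\circ$, at most one edge between two distinct nodes, no self-cycles, no directed cycle and no almost directed cycle (directed path from $i$ to $j$ together with $j\leftrightarrow i$), and no inducing path between non-adjacent nodes (a path all of whose non-endpoint nodes are colliders on it and ancestors, via directed paths, of an endpoint). $*$ stands for any edge mark. A DPAG $P$ contains a DMG $G$ with the same node set if: (1) $i,j$ are adjacent in $P$ iff there is an inducing path between them in $G$; (2) $i\,*\!\!\to j$ in $P$ (i.e. $i\to j$, $i\circ\!\!\to j$ or $i\leftrightarrow j$) implies $j\notin\mathrm{an}_G(i)$; (3) $i\to j$ in $P$ implies $i\in\mathrm{an}_G(j)$. Rule R0. An unshielded triple $\langle a,c,b\rangle$ in $P$ consists of distinct nodes with $a,c$ adjacent, $c,b$ adjacent and $a,b$ non-adjacent. All unshielded triples being oriented according to R0 using $\mathrm{IM}_\sigma(G)$ means: for each unshielded triple $\langle a,c,b\rangle$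 in $P$, $a\,*\!\!\to c\leftarrow\!\!*\,b$ in $P$ iff $c\notin\mathrm{SepSet}(a,b)$, where $\mathrm{SepSet}(a,b)\subseteq V\setminus\{a,b\}$ is a set $Z$ with $\langle\{a\},\{b\},Z\rangle\in\mathrm{IM}_\sigma(G)$. A path $v_0,\dots,v_n$ in $P$ is possibly directed from $v_0$ to $v_n$ if each edge between $v_{m-1}$ and $v_m$ is $v_{m-1}\circ\!\!-\!\!\circ v_m$, $v_{m-1}\circ\!\!\to v_m$ or $v_{m-1}\to v_m$; it is uncovered if $v_{m-2},v_m$ are non-adjacent in $P$ for $m=2,\dots,n$. *)

(* Defs.v *)
From HB Require Import structures.
From mathcomp Require Import all_boot.

Set Implicit Arguments.
Unset Strict Implicit.
Unset Printing Implicit Defensive.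

(** * Directed mixed graphs *)

(* [dir x y] is the edge x -> y; x -> y and y -> x may coexist, also together
   with x <-> y. *)
Record dmg (V : finType) := Dmg {
  dir : rel V;
  bidir : rel V;
  dir_irr : irreflexive dir;
  bidir_irr : irreflexive bidir;
  bidir_sym : symmetric bidir
}.

Definition an (V : finType) (G : dmg V) (j : V) : {set V} :=
  [set i | connect (dir G) i j].

Definition de (V : finType) (G : dmg V) (i : V) : {set V} :=
  [set j | i \in an G j].

Definition sc (V : finType) (G : dmg V) (i : V) : {set V} := an G i :&: de G i.

Definition an_set (V : finType) (G : dmg V) (I : {set V}) : {set V} :=
  \bigcup_(i in I) an G i.

(* An edge between x and y as traversed from x to y: [Fwd] is x -> y, [Bwd] is
   x <- y and [Bid] is x <-> y. *)
Variant dmg_edge := Fwd | Bwd | Bid.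

Definition has_edge (V : finType) (G : dmg V) (e : dmg_edge) (x y : V) : bool :=
  match e with
  | Fwd => dir G x y
  | Bwd => dir G y x
  | Bid => bidir G x y
  end.

Definition head_at_source (e : dmg_edge) : bool :=
  match e with Fwd => false | Bwd | Bid => true end.

Definition head_at_target (e : dmg_edge) : bool :=
  match e with Bwd => false | Fwd | Bid => true end.

(* The walk v0 e1 v1 ... en vn is represented by its first node v0 and the
   sequence [:: (e1, v1); ...; (en, vn)]. *)
Fixpoint is_walk (V : finType) (G : dmg V) (x : V) (w : seq (dmg_edge * V)) :
    bool :=
  if w is (e, y) :: w' then has_edge G e x y && is_walk G y w' else true.

Definition walk_nodes (V : finType) (x : V) (w : seq (dmg_edge * V)) : seq V :=
  x :: unzip2 w.

Definition walk_end (V : finType) (x : V) (w : seq (dmg_edge * V)) : V :=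
  last x (unzip2 w).

Definition is_path (V : finType) (G : dmg V) (x y : V)
    (w : seq (dmg_edge * V)) : bool :=
  [&& is_walk G x w, walk_end x w == y & uniq (walk_nodes x w)].

(* The occurrences of non-endpoint nodes k on the walk, each listed as
   (h, e1, k, e2, l), where h e1 k e2 l is the part of the walk around k. *)
Fixpoint inner (V : finType) (x : V) (w : seq (dmg_edge * V)) :
    seq (V * dmg_edge * V * dmg_edge * V) :=
  if w is (e1, k) :: w' then
    if w' is (e2, l) :: _ then (x, e1, k, e2, l) :: inner k w' else [::]
  else [::].

Definition is_collider (e1 e2 : dmg_edge) : bool :=
  head_at_target e1 && head_at_source e2.

(* On h e1 k e2 l, some directed edge out of k points to a neighbour of k on the
   walk that lies outside sc(k). *)
Definition leaves_sc (V : finType) (G : dmg V) (h : V) (e1 : dmg_edge) (k : V)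
    (e2 : dmg_edge) (l : V) : bool :=
  (if e1 is Bwd then h \notin sc G k else false)
  || (if e2 is Fwd then l \notin sc G k else false).

Definition sigma_blocked (V : finType) (G : dmg V) (C : {set V}) (x : V)
    (w : seq (dmg_edge * V)) : bool :=
  [|| x \in C,
      walk_end x w \in C,
      has (fun t => let: (h, e1, k, e2, l) := t in
             is_collider e1 e2 && (k \notin an_set G C)) (inner x w)
    | has (fun t => let: (h, e1, k, e2, l) := t in
             [&& ~~ is_collider e1 e2, k \in C & leaves_sc G h e1 k e2 l])
          (inner x w)].

Definition sigma_separated (V : finType) (G : dmg V) (A B C : {set V}) : Prop :=
  forall (a b : V) (w : seq (dmg_edge * V)),
    a \in A -> b \in B -> is_path G a b w -> sigma_blocked G C a w.

Definition IM_sigma (V : finType) (G : dmg V)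
    (t : {set V} * {set V} * {set V}) : Prop :=
  let: (A, B, C) := t in sigma_separated G A B C.

Definition inducing_path (V : finType) (G : dmg V) (i j : V)
    (w : seq (dmg_edge * V)) : bool :=
  is_path G i j w
  && all (fun t => let: (h, e1, k, e2, l) := t in
            if is_collider e1 e2 then k \in an_set G [set i; j]
            else ~~ leaves_sc G h e1 k e2 l) (inner i w).

(** * Directed partial ancestral graphs *)

(* An edge between x and y as seen from x:
   [PTo] is x -> y, [PFrom] is x <- y, [PBi] is x <-> y, [PCircTo] is x o-> y,
   [PFromCirc] is x <-o y and [PCirc] is x o-o y. *)
Variant pedge := PTo | PFrom | PBi | PCircTo | PFromCirc | PCirc.

Definition pflip (e : pedge) : pedge :=
  match e with
  | PTo => PFrom
  | PFrom => PTo
  | PBi => PBi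
  | PCircTo => PFromCirc
  | PFromCirc => PCircTo
  | PCirc => PCirc
  end.

(* The option type provides for at most one edge between two nodes. *)
Record pmixed (V : finType) := PMixed {
  pedge_of : V -> V -> option pedge;
  pedge_flip : forall x y, pedge_of y x = omap pflip (pedge_of x y);
  pedge_irr : forall x, pedge_of x x = None
}.

Definition padj (V : finType) (P : pmixed V) : rel V :=
  fun x y => isSome (pedge_of P x y).

Definition pdir (V : finType) (P : pmixed V) : rel V :=
  fun x y => if pedge_of P x y is Some PTo then true else false.

Definition pbidir (V : finType) (P : pmixed V) : rel V :=
  fun x y => if pedge_of P x y is Some PBi then true else false.

(* x *-> y *)
Definition pinto (V : finType) (P : pmixed V) : rel V :=
  fun x y => if pedge_of P x y is Some (PTo | PBi | PCircTo) then true
             else false.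

(* x -> y, x o-> y or x o-o y *)
Definition ppossdir (V : finType) (P : pmixed V) : rel V :=
  fun x y => if pedge_of P x y is Some (PTo | PCircTo | PCirc) then true
             else false.

(* The consecutive triples (v_(m-2), v_(m-1), v_m) of x :: p. *)
Fixpoint triples (V : finType) (x : V) (p : seq V) : seq (V * V * V) :=
  if p is y :: p' then
    if p' is z :: _ then (x, y, z) :: triples y p' else [::]
  else [::].

(* There is at most one edge between two nodes, so a path with respect to the
   edges in [e] is determined by its nodes x :: p. *)
Definition ppath (V : finType) (e : rel V) (x y : V) (p : seq V) : bool :=
  [&& path e x p, last x p == y & uniq (x :: p)].

Definition pinducing_path (V : finType) (P : pmixed V) (i j : V) (p : seq V) :
    bool :=
  ppath (padj P) i j p
  && all (fun t => let: (h, k, l) := t in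
            [&& pinto P h k, pinto P l k
              & connect (pdir P) k i || connect (pdir P) k j]) (triples i p).

Record dpag (V : finType) := Dpag {
  dpag_graph :> pmixed V;
  dpag_acyclic : forall i j,
    connect (pdir dpag_graph) i j -> ~~ pdir dpag_graph j i;
  dpag_almost_acyclic : forall i j,
    connect (pdir dpag_graph) i j -> ~~ pbidir dpag_graph j i;
  dpag_maximal : forall i j p,
    i != j -> ~~ padj dpag_graph i j -> ~~ pinducing_path dpag_graph i j p
}.

(* A trivial path is vacuously inducing, hence [i != j] in the first clause. *)
Definition contains (V : finType) (P : dpag V) (G : dmg V) : Prop :=
  [/\ forall i j, i != j ->
        (padj P i j <-> exists w, inducing_path G i j w),
      forall i j, pinto P i j -> j \notin an G i
    & forall i j, pdir P i j -> i \in an G j].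

Definition unshielded (V : finType) (P : dpag V) (a c b : V) : bool :=
  [&& uniq [:: a; c; b], padj P a c, padj P c b & ~~ padj P a b].

(* [SepSet] is an arbitrary choice of separating sets. *)
Definition oriented_R0 (V : finType) (P : dpag V) (G : dmg V) : Prop :=
  exists SepSet : V -> V -> {set V},
  forall a c b, unshielded P a c b ->
    [/\ SepSet a b \subset ~: [set a; b],
        IM_sigma G ([set a], [set b], SepSet a b)
      & pinto P a c && pinto P b c <-> c \notin SepSet a b].

Definition uncovered (V : finType) (P : dpag V) (x : V) (p : seq V) : bool :=
  all (fun t => let: (h, _, l) := t in ~~ padj P h l) (triples x p).

Definition uncovered_possibly_directed_path (V : finType) (P : dpag V)
    (x y : V) (p : seq V) : bool :=
  ppath (ppossdir P) x y p && uncovered P x p.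

(* Main.v *)
Require Import Defs.
From HB Require Import structures.
From mathcomp Require Import all_boot.

Set Implicit Arguments.
Unset Strict Implicit.
Unset Printing Implicit Defensive.

(** Say that [c] is a strict ancestor of [x] if c is in an(x) but x is not in
    an(c).  The key fact ([sepset_strict_ancestor]) is that the middle node c of
    an unshielded triple <a, c, b> with c in SepSet(a, b) is a strict ancestor
    of a or of b.

    This settles the second case.  No edge of a possibly directed path has an
    arrowhead at the node from which it is traversed, so R0 puts i in
    SepSet(u, v), and by symmetry i may be assumed a strict ancestor of u.
    Strictness then propagates along the uncovered path: each inner node y with
    predecessor x and successor z is a strict ancestor of x or of z, and x, being
    a strict ancestor of y, excludes the former.  The directed path is thus
    built link by link up to j.  (In the first case each edge of the path is an
    ancestral relation by containment.)

    For the key fact, let c be in Z = SepSet(a, b) and a strict ancestor of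
    neither a nor b.  For each endpoint x there is a walk from c to x that leaves
    c along an arrowhead at c, or along an arrow into the strongly connected
    component of c ([walk_from_middle]): if c is not an ancestor of x, the
    inducing path has this property, since an arrow c -> k starts a directed
    subwalk that stops at x or at a collider, so that k is in an({c, x}) and hence
    in an(c); if c and x share a component, a directed path between them does.
    Joined at c, the two walks form a walk from a to b on which c does not
    sigma-block although c is in Z: it is a collider in Z or has arrows only into
    its own component.  All colliders are ancestors of Z, a or b.  Those that are
    not ancestors of Z are removed by detours along directed paths to a and to b
    ([detour_to_end]), and loops are cut ([open_simple]); the result is a path
    that is not sigma-blocked by Z, against the choice of Z. *)

(** * Open walks *)

Definition arrow_ok (V : finType) (G : dmg V) (F : {set V}) (k l : V) : bool :=
  (k \in F) ==> (l \in sc G k).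

Definition edge_ok (V : finType) (G : dmg V) (F : {set V}) (e : dmg_edge)
    (x y : V) : bool :=
  match e with
  | Fwd => arrow_ok G F x y
  | Bwd => arrow_ok G F y x
  | Bid => true
  end.

(** A node with an outgoing arrow on the walk is never a collider, so the
    condition on non-colliders can be imposed on each arrow separately.  This
    makes openness stable under cutting and joining walks except for the colliders
    at the seam; the mark [h], telling whether the first node is entered through an
    arrowhead, takes care of these.  With F = C and S = an(C) this is being unblocked
    by C for walks with endpoints outside C; other choices of S and F describe
    inducing paths and intermediate walks. *)
Fixpoint open_from (V : finType) (G : dmg V) (S F : {set V}) (h : bool) (x : V)
    (w : seq (dmg_edge * V)) : bool :=
  if w is (e, y) :: w' then
    [&& has_edge G e x y, edge_ok G F e x y,
        (h && head_at_source e) ==> (x \in S)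
      & open_from G S F (head_at_target e) y w']
  else true.

Definition ancestral (V : finType) (G : dmg V) (S : {set V}) : Prop :=
  forall x y, connect (dir G) x y -> y \in S -> x \in S.

Definition first_head (V : finType) (w : seq (dmg_edge * V)) : bool :=
  if w is (e, _) :: _ then head_at_source e else false.

Fixpoint last_head (V : finType) (h : bool) (w : seq (dmg_edge * V)) : bool :=
  if w is (e, _) :: w' then last_head (head_at_target e) w' else h.

Lemma in_sc (V : finType) (G : dmg V) (k l : V) :
  (l \in sc G k) = connect (dir G) l k && connect (dir G) k l.
Proof. by rewrite !inE. Qed.

Lemma an_setP (V : finType) (G : dmg V) (C : {set V}) (x : V) :
  reflect (exists2 z, z \in C & connect (dir G) x z) (x \in an_set G C).
Proof.
apply: (iffP bigcupP) => [[z zC]|[z zC xz]]; last by exists z; rewrite ?inE.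
by rewrite inE; exists z.
Qed.

Lemma ancestral_an_set (V : finType) (G : dmg V) (C : {set V}) :
  ancestral G (an_set G C).
Proof.
move=> x y xy /an_setP [z zC yz]; apply/an_setP; exists z => //.
exact: connect_trans xy yz.
Qed.

Lemma open_from_cat (V : finType) (G : dmg V) (S F : {set V}) h x w1 w2 :
  open_from G S F h x (w1 ++ w2) =
  open_from G S F h x w1 &&
  open_from G S F (last_head h w1) (walk_end x w1) w2.
Proof.
elim: w1 h x => [|[e y] w1 IH] h x //=.
by rewrite IH -!andbA.
Qed.

(** Used to join walks at a node of S, which is an admissible collider. *)
Lemma open_from_mem (V : finType) (G : dmg V) (S F : {set V}) h h' x w :
  x \in S -> open_from G S F h x w -> open_from G S F h' x w.
Proof.
by case: w => [|[e y] w] //= xS; rewrite xS !implybT.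
Qed.

Lemma open_is_walk (V : finType) (G : dmg V) (S F : {set V}) h x w :
  open_from G S F h x w -> is_walk G x w.
Proof.
by elim: w h x => [|[e y] w IH] h x //= /and4P [-> _ _ /IH].
Qed.

(** Once entered through an arrowhead, a walk either meets a collider after some
    directed edges, or is directed up to its last node. *)
Lemma open_entered (V : finType) (G : dmg V) (S F : {set V}) x w :
  ancestral G S -> open_from G S F true x w ->
  x \in S \/ last_head true w /\ connect (dir G) x (walk_end x w).
Proof.
move=> anS; elim: w x => [|[e y] w IH] x /=.
  by move=> _; right; split; rewrite // connect0.
case/and4P; case: e => /=; try by move=> _ _ xS _; left.
move=> xy _ _ /IH [yS|[lh yend]].
  by left; apply: anS yS; apply: connect1.
by right; split=> //; apply: connect_trans (connect1 xy) yend.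
Qed.

(** Cutting a loop at x may turn x into a collider.  The walk then reaches the loop
    through an arrowhead at x and continues after it along an edge with an arrowhead
    at x.  By [open_entered], the walk goes from x along directed edges to a
    collider, which may be x itself at the end of the loop; this puts x in S. *)
Lemma open_cut_loop (V : finType) (G : dmg V) (S F : {set V}) h x w1 w2 :
  ancestral G S -> walk_end x w1 = x ->
  open_from G S F h x (w1 ++ w2) -> open_from G S F h x w2.
Proof.
move=> anS end1; rewrite open_from_cat end1 => /andP [].
case: w2 => [|[e y] w2] //= open1 /and4P [-> -> /implyP hx ->].
rewrite andbT /=; apply/implyP=> /andP [hT se].
move: open1 hx; rewrite hT se andbT => /(open_entered anS) [//|[lh _]].
exact.
Qed.

Lemma open_simple (V : finType) (G : dmg V) (S F : {set V}) h x w :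
  ancestral G S -> open_from G S F h x w ->
  exists w', [/\ open_from G S F h x w', walk_end x w' = walk_end x w,
    uniq (walk_nodes x w') & {subset walk_nodes x w' <= walk_nodes x w}].
Proof.
move=> anS; have [n] := ubnP (size w).
elim: n h x w => // n IH h x [|[e y] w] ltn openw.
  by exists [::]; split=> // z.
have [xin|xnin] := boolP (x \in unzip2 ((e, y) :: w)); last first.
  move: openw => /= /and4P [He ok hx /IH [|w' [openw' end' uniq' sub']]] //.
  exists ((e, y) :: w'); split=> //=.
  - by apply/and4P.
  - have xy : x \notin walk_nodes y w' by apply: contra xnin => /sub'.
    by rewrite -[_ :: unzip2 w']/(walk_nodes y w') xy.
  move=> z; rewrite /walk_nodes /= inE => /orP [/eqP ->|/sub' zin].
    exact: mem_head.
  by rewrite inE zin orbT.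
set w0 := (e, y) :: w in xin ltn openw *.
pose m := (index x (unzip2 w0)).+1.
have ltm : index x (unzip2 w0) < size w0 by rewrite -(size_map snd) index_mem.
have endm : walk_end x (take m w0) = x.
  rewrite /walk_end /unzip2 map_take (take_nth x) ?size_map //.
  by rewrite last_rcons nth_index.
have openD : open_from G S F h x (drop m w0).
  by apply: open_cut_loop anS endm _; rewrite cat_take_drop.
have endD : walk_end x (drop m w0) = walk_end x w0.
  rewrite -{2}(cat_take_drop m w0) /walk_end /unzip2 map_cat last_cat.
  by move: endm; rewrite /walk_end /unzip2 => ->.
have [|w' [ow' end' uniq' sub']] := IH _ _ _ _ openD.
  rewrite size_drop /m; apply: leq_trans (ltn : size w0 <= n).
  by rewrite ltn_subrL.
exists w'; split=> //; first by rewrite end'.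
move=> z /sub'; rewrite !inE => /orP [->//|zin]; apply/orP; right.
by move: zin; rewrite /unzip2 map_drop => /mem_drop.
Qed.

Lemma open_not_blocked (V : finType) (G : dmg V) (C : {set V}) x w :
  x \notin C -> walk_end x w \notin C ->
  open_from G (an_set G C) C false x w -> ~~ sigma_blocked G C x w.
Proof.
move=> /negbTE xC /negbTE eC; rewrite /sigma_blocked xC eC /= => openw.
have : ~~ has (fun t => let: (h, e1, k, e2, l) := t in
    is_collider e1 e2 && (k \notin an_set G C) ||
    [&& ~~ is_collider e1 e2, k \in C & leaves_sc G h e1 k e2 l]) (inner x w).
  elim: w x false openw {xC eC} => [|[e1 k] [|[e2 l] w] IH] x h //.
  case/and4P=> _ ok1 _ open2; have /and4P [_ ok2 col2 _] := open2.
  have := IH _ _ open2.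
  rewrite -[inner x _]/((x, e1, k, e2, l) :: inner k ((e2, l) :: w)).
  rewrite -[_ :: inner _ _]cat1s has_cat has_seq1 negb_or => ->; rewrite andbT negb_or.
  rewrite /is_collider /leaves_sc.
  case: e1 e2 ok1 ok2 col2 {IH open2} => [] [] /=; rewrite /arrow_ok;
    case: (k \in C); case: (k \in an_set G C) => //=;
    case: (x \in sc G k) => //=; by case: (l \in sc G k).
by apply: contra; rewrite -has_predU; apply: sub_has => [[[[[h e1] k] e2] l]].
Qed.

Lemma open_not_separated (V : finType) (G : dmg V) (C : {set V}) a b w :
  a \notin C -> b \notin C -> walk_end a w = b ->
  open_from G (an_set G C) C false a w ->
  ~ sigma_separated G [set a] [set b] C.
Proof.
move=> aC bC endw openw sep.
have [w' [openw' endw' uniqw' _]] := open_simple (@ancestral_an_set V G C) openw.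
have := open_not_blocked aC _ openw'; rewrite endw' endw => /(_ bC) /negP; apply.
apply: (sep a b); rewrite ?inE //.
by rewrite /is_path (open_is_walk openw') endw' endw eqxx.
Qed.

(** * Joining walks and detours *)

Definition eflip (e : dmg_edge) : dmg_edge :=
  match e with Fwd => Bwd | Bwd => Fwd | Bid => Bid end.

(** The reverse of [w], from its last node back to [x], continued by [acc]. *)
Fixpoint catrev_walk (V : finType) (x : V) (w acc : seq (dmg_edge * V)) :
    seq (dmg_edge * V) :=
  if w is (e, y) :: w' then catrev_walk y w' ((eflip e, x) :: acc) else acc.

Lemma catrev_walk_end (V : finType) (x : V) w acc :
  walk_end (walk_end x w) (catrev_walk x w acc) = walk_end x acc.
Proof. by elim: w x acc => [|[e y] w IH] x acc //=; rewrite [LHS]IH. Qed.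

Lemma open_catrev (V : finType) (G : dmg V) (S F : {set V}) x w acc :
  open_from G S F (first_head acc) x w -> open_from G S F (first_head w) x acc ->
  open_from G S F false (walk_end x w) (catrev_walk x w acc).
Proof.
elim: w x acc => [|[e y] w IH] x acc //=.
case/and4P=> He ok _ openw openacc; apply: IH; first by case: e openw {He ok openacc}.
have colw : (first_head w && head_at_target e) ==> (y \in S).
  by case: w openw => [|[f z] w] //= /and4P [_ _]; rewrite andbC.
apply/and4P; split.
- by case: e He {ok openw colw openacc} => //=; rewrite bidir_sym.
- by case: e ok {He openw colw openacc}.
- by case: e colw {He ok openw openacc}.
- by case: e openacc {He ok openw colw}.
Qed.

Lemma open_directed (V : finType) (G : dmg V) (S F : {set V}) x y :
  connect (dir G) x y ->
  (forall k l, connect (dir G) x k -> dir G k l -> connect (dir G) l y ->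
     arrow_ok G F k l) ->
  exists w, walk_end x w = y /\ forall h, open_from G S F h x w.
Proof.
case/connectP=> p; elim: p x => [|z p IH] x /= => [_ -> _|].
  by exists [::].
case/andP=> xz pz yE ok.
have [k l zk|w [endw openw]] := IH z pz yE.
  by apply: ok; apply: connect_trans (connect1 xz) zk.
exists ((Fwd, z) :: w); split=> // h /=.
rewrite xz openw andbF /= andbT; apply: ok => //.
by apply/connectP; exists p.
Qed.

(** At the first collider that is in an(b) but not in the smaller set S, the walk
    can be continued by a directed path to b.  This path avoids F because it
    consists of descendants of a node outside the ancestral set S. *)
Lemma detour_to_end (V : finType) (G : dmg V) (S F : {set V}) b h x w :
  ancestral G S -> F \subset S -> walk_end x w = b ->
  open_from G (S :|: an G b) F h x w ->
  exists w', walk_end x w' = b /\ open_from G S F h x w'.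
Proof.
move=> anS /subsetP FS; elim: w h x => [|[e y] w IH] h x /=.
  by move=> endx _; exists [::].
move=> endw /and4P [He ok col /(IH _ _ endw) [w' [endw' openw']]].
have [xS|xS] := boolP ((h && head_at_source e) ==> (x \in S)).
  by exists ((e, y) :: w'); split=> //=; apply/and4P.
move: xS; rewrite negb_imply => /andP [he xS].
move: col; rewrite he /= !inE (negbTE xS) /= => xb.
have [|w0 [end0 open0]] := @open_directed V G S F x b xb.
  move=> k l xk _ _; apply/implyP=> /FS kS; case/negP: xS; exact: anS xk kS.
by exists w0.
Qed.

(** * Walks leaving the middle of an unshielded triple *)

(** The inducing condition controls the arrows out of inner nodes, and the last node
    is outside F; only a first arrow out of x is left to an extra hypothesis. *)
Lemma open_of_inner (V : finType) (G : dmg V) (S F : {set V}) h x w :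
  is_walk G x w -> walk_end x w \notin F ->
  all (fun t => let: (h, e1, k, e2, l) := t in
         if is_collider e1 e2 then k \in S else ~~ leaves_sc G h e1 k e2 l)
      (inner x w) ->
  (if w is (Fwd, y) :: _ then arrow_ok G F x y else true) ->
  (h && first_head w ==> (x \in S)) ->
  open_from G S F h x w.
Proof.
elim: w h x => [|[e y] w IH] h x //= /andP [He walkw] endw inn start ->.
rewrite He /=; have {}endw : walk_end y w \notin F := endw.
case: w IH walkw endw inn => [|[f z] w] IH walkw endw.
  by move=> _; rewrite andbT; case: e start {He} => //= _; rewrite /arrow_ok (negbTE endw).
case/andP=> yok inn; apply/andP; split.
  case: e f yok start {He IH walkw endw inn} => [] [] //=; rewrite /leaves_sc /arrow_ok /=.
  - by rewrite negb_or !negbK => /andP [-> _] _; rewrite implybT.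
  - by rewrite orbF negbK => -> _; rewrite implybT.
  - by rewrite orbF negbK => -> _; rewrite implybT.
apply: IH => //.
- case: f yok {walkw endw inn} => //; rewrite /is_collider andbF /leaves_sc.
  by rewrite negb_or !negbK => /andP [_ zk]; rewrite /arrow_ok zk implybT.
- apply/implyP=> col; move: yok; rewrite /is_collider.
  by rewrite /= in col; rewrite col.
Qed.

(** The exit from c is what matters here: even if c lies in F, no arrow of the walk
    leads from c to another strongly connected component. *)
Lemma walk_from_middle (V : finType) (G : dmg V) (S F : {set V}) c x w :
  ancestral G S -> c \in S -> x \in S -> x \notin F ->
  inducing_path G c x w ->
  ~~ (connect (dir G) c x && ~~ connect (dir G) x c) ->
  exists w', walk_end c w' = x /\ open_from G S F false c w'.
Proof.
move=> anS cS xS xF ind; rewrite negb_and negbK.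
have [cx /= xc|cx _] := boolP (connect (dir G) c x).
  have [|w' [endw' openw']] := @open_directed V G S F c x cx.
    move=> k l ck kl lx; apply/implyP=> _; rewrite in_sc (connect1 kl) andbT.
    exact: connect_trans lx (connect_trans xc ck).
  by exists w'.
case/andP: ind => /and3P [walkw /eqP endw _] inn.
exists w; split=> //; apply: open_of_inner => //; first by rewrite endw.
- apply: sub_all inn => [[[[[h e1] k] e2] l]].
  case: ifP => // _ /an_setP [z]; rewrite !inE => /orP [] /eqP -> kz;
    exact: anS kz _.
- case: w walkw endw inn => [|[[] k] w] //= /andP [ck walkw] endw inn.
  (* With no constraint on arrows, the rest of the inducing path is open and is
     entered through an arrowhead at k. *)
  have open0 : open_from G (an_set G [set c; x]) set0 false c ((Fwd, k) :: w).
    apply: open_of_inner; rewrite /arrow_ok ?inE //=.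
    by apply/andP.
  case/and4P: open0 => _ _ _ /(open_entered (@ancestral_an_set V G _)) kc.
  have {}kc : k \in an_set G [set c; x].
    case: kc => // [[_ kx]]; apply/an_setP; exists x; rewrite ?inE ?eqxx ?orbT //.
    by move: kx; rewrite [walk_end _ _]endw.
  apply/implyP=> _; rewrite in_sc (connect1 ck) andbT.
  case/an_setP: kc => z; rewrite !inE => /orP [] /eqP -> // kx.
  by case/negP: cx; apply: connect_trans (connect1 ck) kx.
Qed.

(** Membership of c in Z serves twice: it makes c an admissible collider where the
    two walks are joined, and it makes the ancestors of c, which an inducing path
    ending at c allows as colliders, ancestors of Z. *)
Lemma sepset_strict_ancestor (V : finType) (G : dmg V) (Z : {set V}) a b c wa wb :
  a \notin Z -> b \notin Z -> c \in Z ->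
  inducing_path G c a wa -> inducing_path G c b wb ->
  sigma_separated G [set a] [set b] Z ->
  connect (dir G) c a && ~~ connect (dir G) a c \/
  connect (dir G) c b && ~~ connect (dir G) b c.
Proof.
move=> aZ bZ cZ inda indb sep; apply/orP; apply: contraT.
rewrite negb_or => /andP [na nb]; exfalso; move: sep.
have anZ := @ancestral_an_set V G Z.
have subZ : Z \subset an_set G Z.
  by apply/subsetP=> z zZ; apply/an_setP; exists z; rewrite ?connect0.
pose Sb := an_set G Z :|: an G b; pose S := Sb :|: an G a.
have anb : ancestral G Sb.
  move=> x y xy; rewrite !inE => /orP [/(anZ _ _ xy) ->//|yb].
  by rewrite (connect_trans xy yb) orbT.
have anS : ancestral G S.
  move=> x y xy; rewrite in_setU => /orP [/(anb _ _ xy) yS|].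
    by rewrite in_setU yS.
  by rewrite !inE => ya; rewrite (connect_trans xy ya) !orbT.
have cS : c \in S by rewrite !inE (subsetP subZ _ cZ).
have aS : a \in S by rewrite !inE connect0 !orbT.
have bS : b \in S by rewrite !inE connect0 !orbT.
have [wa' [enda opena]] := walk_from_middle anS cS aS aZ inda na.
have [wb' [endb openb]] := walk_from_middle anS cS bS bZ indb nb.
have openba : open_from G S Z false b (catrev_walk c wb' wa').
  by rewrite -endb; apply: open_catrev; apply: open_from_mem cS _; eassumption.
have endba : walk_end b (catrev_walk c wb' wa') = a.
  by rewrite -{1}endb catrev_walk_end.
have [|w1 [end1 open1]] := detour_to_end anb _ endba openba.
  by apply: subset_trans subZ _; apply: subsetUl.
have open1r : open_from G Sb Z false a (catrev_walk b w1 [::]).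
  by rewrite -{1}end1; apply: open_catrev.
have end1r : walk_end a (catrev_walk b w1 [::]) = b.
  by rewrite -{1}end1 catrev_walk_end.
have [w2 [end2 open2]] := detour_to_end anZ subZ end1r open1r.
exact: open_not_separated aZ bZ end2 open2.
Qed.

(** * Unshielded triples and uncovered paths *)

Lemma padj_sym (V : finType) (P : pmixed V) : symmetric (padj P).
Proof. by move=> x y; rewrite /padj (pedge_flip P x y); case: pedge_of. Qed.

Lemma ppossdir_padj (V : finType) (P : pmixed V) x y :
  ppossdir P x y -> padj P x y.
Proof. by rewrite /ppossdir /padj; case: pedge_of. Qed.

Lemma ppossdir_not_pinto (V : finType) (P : pmixed V) x y :
  ppossdir P x y -> ~~ pinto P y x.
Proof.
rewrite /ppossdir /pinto (pedge_flip P x y).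
by case: pedge_of => [[]|].
Qed.

Lemma unshielded_strict_ancestor (V : finType) (G : dmg V) (P : dpag V) a c b :
  contains P G -> oriented_R0 P G -> unshielded P a c b -> ppossdir P c b ->
  connect (dir G) c a && ~~ connect (dir G) a c \/
  connect (dir G) c b && ~~ connect (dir G) b c.
Proof.
move=> [adjP _ _] [SepSet R0] unsh cb.
have [/subsetP sub sep colE] := R0 _ _ _ unsh.
have cZ : c \in SepSet a b.
  apply: contraT => /colE /andP [_ bc].
  by case/negP: (ppossdir_not_pinto cb).
case/and4P: unsh; rewrite /= !inE negb_or => /and3P [/andP [ac ab] cb' _] adjac adjcb _.
have [wb indb] := (adjP _ _ cb').1 adjcb.
rewrite eq_sym in ac; rewrite padj_sym in adjac.
have [wa inda] := (adjP _ _ ac).1 adjac.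
apply: sepset_strict_ancestor cZ inda indb sep.
- by apply/negP=> /sub; rewrite !inE eqxx.
- by apply/negP=> /sub; rewrite !inE eqxx orbT.
Qed.

Lemma uncovered_ancestor (V : finType) (G : dmg V) (P : dpag V) x y p :
  contains P G -> oriented_R0 P G ->
  path (ppossdir P) x (y :: p) -> uncovered P x (y :: p) -> uniq (x :: y :: p) ->
  connect (dir G) x y && ~~ connect (dir G) y x ->
  connect (dir G) x (last y p).
Proof.
move=> hPG hR0; elim: p x y => [|z p IH] x y; first by move=> _ _ _ /andP [].
move=> /= /andP [xy pathy] /andP [xz unc] uniqx /andP [cxy nyx].
apply: connect_trans cxy _.
have [xNyzp uniqy] := andP uniqx.
have yz : ppossdir P y z by case/andP: pathy.
apply: IH => //.
have unsh : unshielded P x y z.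
  rewrite /unshielded (ppossdir_padj xy) (ppossdir_padj yz) xz !andbT /=.
  move: xNyzp uniqy; rewrite /= !inE !negb_or => /and3P [-> -> _].
  by case/andP=> /andP [-> _].
case: (unshielded_strict_ancestor hPG hR0 unsh yz) => // /andP [yx _].
by rewrite yx in nyx.
Qed.

Theorem proposition4 (V : finType) (G : dmg V) (P : dpag V)
    (hPG : contains P G) (hR0 : oriented_R0 P G)
    (i j : V) (hij : i != j)
    (h : (exists p : seq V, ppath (pdir P) i j p) \/
         (exists (u v : V) (p q : seq V),
            [/\ uncovered_possibly_directed_path P i j (u :: p),
                uncovered_possibly_directed_path P i j (v :: q),
                u != v
              & ~~ padj P u v])) :
  i \in an G j.
Proof.
rewrite inE; case: h => [[p /and3P [pathp /eqP <- _]]|].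
  have dirP x y : pdir P x y -> connect (dir G) x y.
    by case: hPG => _ _ dirP /dirP; rewrite inE.
  elim: p i pathp {hij} => [|y p IH] x /=; first by rewrite connect0.
  by case/andP=> /dirP xy /IH; apply: connect_trans.
case=> u [v [p [q []]]] /andP [/and3P [pathu /eqP endu uniqu] uncu].
case/andP=> /and3P [pathv /eqP endv uniqv] uncv uv adjuv.
have iu : ppossdir P i u by case/andP: pathu.
have iv : ppossdir P i v by case/andP: pathv.
have unsh : unshielded P u i v.
  rewrite /unshielded padj_sym (ppossdir_padj iu) (ppossdir_padj iv) adjuv /=.
  rewrite !andbT !inE negb_or uv andbT eq_sym.
  move: uniqu uniqv; rewrite /= !inE !negb_or.
  by case/andP=> /andP [-> _] _ /andP [/andP [-> _] _].
case: (unshielded_strict_ancestor hPG hR0 unsh iv) => strict.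
- by rewrite -endu; apply: (uncovered_ancestor hPG hR0 pathu uncu uniqu strict).
- by rewrite -endv; apply: (uncovered_ancestor hPG hR0 pathv uncv uniqv strict).
Qed.
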